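(* Let $A\subset\mathbb R^p$ be a self-similar fractal, fixed under $M$ similitudes with equal contraction ratios, let $d=\dim_H A$ and $s>d$. For an infinite set (increasing sequence) $\mathfrak N\subset\mathbb N$ write $$\{\mathfrak N\}:=\lim_{\mathfrak N\ni N\to\infty}\{\log_M N\},\qquad E_s(\mathfrak N):=\lim_{\mathfrak N\ni N\to\infty}\frac{\mathcal E_s(A,N)}{N^{1+s/d}}$$ whenever the corresponding limit exists, where $\{\log_M N\}$ denotes the fractional part of $\log_M N$. If two sequences $\mathfrak N_1,\mathfrak N_2\subset\mathbb N$ are such that the limits $\{\mathfrak N_1\}$ and $\{\mathfrak N_2\}$ exist and $$\{\mathfrak N_1\}=\{\mathfrak N_2\},$$ then the limits $E_s(\mathfrak N_1)$ and $E_s(\mathfrak N_2)$ exist and $$E_s(\mathfrak N_1)=E_s(\mathfrak N_2).$$ Moreover, the function $g_{s,d}:\{\mathfrak N\}\mapsto E_s(\mathfrak N)$ is continuous on $[0,1]$.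
   Context: A similitude of $\mathbb R^p$ is a map $\psi(\boldsymbol x)=rO(\boldsymbol x)+\boldsymbol z$ with $O$ an orthogonal $p\times p$ matrix, $\boldsymbol z\in\mathbb R^p$, and contraction ratio $0<r<1$. A nonempty compact set $A\subset\mathbb R^p$ is a self-similar fractal with (fixed under) similitudes $\psi_1,\dots,\psi_M$ ($M\ge2$), with contraction ratios $r_1,\dots,r_M$, if $A=\bigcup_{m=1}^M\psi_m(A)$, where the union is disjoint. Its Hausdorff dimension $d=\dim_H A$ satisfies $\sum_{m=1}^M r_m^d=1$; when all ratios equal $r$, this reads $Mr^d=1$. For a finite set $\omega_N=\{\boldsymbol x_1,\dots,\boldsymbol x_N\}$ of $N$ distinct points, $E_s(\omega_N):=\sum_{i\ne j}|\boldsymbol x_i-\boldsymbol x_j|^{-s}$ (sum over ordered pairs), and for $N\ge2$, $\mathcal E_s(A,N):=\inf\{E_s(\omega_N):\omega_N\subset A,\ \#\omega_N=N\}$. The function $g_{s,d}$ assigns to $a\in[0,1]$ the common value of $E_s(\mathfrak N)$ over all sequences $\mathfrak N$ with $\{\mathfrak N\}=a$ (both $a=0$ and $a=1$ are possible limits of fractional parts). *)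

(* Defs.v *)
From HB Require Import structures.
From mathcomp Require Import all_boot all_order all_algebra.
From mathcomp Require Import all_classical all_reals all_analysis.
Import numFieldNormedType.Exports.
Import Order.TTheory GRing.Theory Num.Theory.

Set Implicit Arguments.
Unset Strict Implicit.
Unset Printing Implicit Defensive.

Local Open Scope classical_set_scope.
Local Open Scope ring_scope.

(* The library norm `|x| on 'cV[R]_p is the sup norm; it induces the same
   topology (hence the same [compact]) as this one. *)
Definition euclid_norm (R : realType) (p : nat) (x : 'cV[R]_p) : R :=
  Num.sqrt (\sum_i x i ord0 ^+ 2).

(* 0 is adjoined so that the empty set has diameter 0 rather than -oo. *)
Definition diameter (R : realType) (p : nat) (U : set 'cV[R]_p) : \bar R :=
  ereal_sup (0%E |` [set (euclid_norm (x - y))%:E | x in U & y in U]).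

Definition hausdorff_premeasure (R : realType) (p : nat) (t delta : R)
    (A : set 'cV[R]_p) : \bar R :=
  ereal_inf [set (\sum_(0 <= i <oo) poweR (diameter (U i)) t)%E | U in
    [set U : nat -> set 'cV[R]_p |
      A `<=` \bigcup_i U i /\ forall i, (diameter (U i) <= delta%:E)%E]].

Definition hausdorff_measure (R : realType) (p : nat) (t : R)
    (A : set 'cV[R]_p) : \bar R :=
  ereal_sup [set hausdorff_premeasure t delta A | delta in [set e : R | 0 < e]].

(* Only exponents t > 0 are used (this does not change the infimum), so that
   the value of 0 ^ 0 is irrelevant. *)
Definition hausdorff_dim (R : realType) (p : nat) (A : set 'cV[R]_p) : \bar R :=
  ereal_inf [set t%:E | t in [set t : R | 0 < t /\ hausdorff_measure t A = 0%E]].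

Definition similitude (R : realType) (p : nat) (r : R)
    (psi : 'cV[R]_p -> 'cV[R]_p) : Prop :=
  0 < r < 1 /\
  exists (O : 'M[R]_p) (z : 'cV[R]_p),
    O^T *m O = 1%:M /\ forall x, psi x = r *: (O *m x) + z.

Definition self_similar_fractal (R : realType) (p M : nat) (r : 'I_M -> R)
    (psi : 'I_M -> 'cV[R]_p -> 'cV[R]_p) (A : set 'cV[R]_p) : Prop :=
  [/\ (2 <= M)%N, A !=set0 /\ compact A,
      forall m, similitude (r m) (psi m),
      A = \bigcup_m (psi m @` A) &
      trivIset setT (fun m => psi m @` A)].

(* A configuration of N distinct points is an injective family. *)
Definition riesz_energy (R : realType) (p : nat) (s : R) (N : nat)
    (x : 'I_N -> 'cV[R]_p) : R :=
  \sum_(i < N) \sum_(j < N | i != j) euclid_norm (x i - x j) `^ (- s).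

Definition min_riesz_energy (R : realType) (p : nat) (s : R)
    (A : set 'cV[R]_p) (N : nat) : R :=
  inf [set riesz_energy s x | x in
    [set x : 'I_N -> 'cV[R]_p | injective x /\ forall i, A (x i)]].

Definition frac_part (R : realType) (x : R) : R := x - (Num.floor x)%:~R.

(* {NN} exists and equals a; [within NN \oo] is the filter of N --> oo
   with N in NN. *)
Definition frac_log_limit (R : realType) (M : nat) (NN : set nat) (a : R)
    : Prop :=
  (fun N : nat => frac_part (ln (N%:R : R) / ln (M%:R : R)))
    @ within NN \oo --> a.

(* E_s(NN) exists and equals e. *)
Definition energy_limit (R : realType) (p : nat) (s d : R)
    (A : set 'cV[R]_p) (NN : set nat) (e : R) : Prop :=
  (fun N : nat => min_riesz_energy s A N / N%:R `^ (1 + s / d))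
    @ within NN \oo --> e.

(* g assigns to each a in [0, 1] the common value of E_s(NN) over all infinite
   NN with {NN} = a; the first conjunct says that there is such an NN, so that
   g a is determined. *)
Definition limit_energy_function (R : realType) (p M : nat) (s d : R)
    (A : set 'cV[R]_p) (g : R -> R) : Prop :=
  forall a : R, 0 <= a <= 1 ->
    (exists NN : set nat, infinite_set NN /\ frac_log_limit M NN a) /\
    (forall NN : set nat, infinite_set NN -> frac_log_limit M NN a ->
      energy_limit s d A NN (g a)).

(* Main.v *)
Require Import Defs.
From HB Require Import structures.
From mathcomp Require Import all_boot all_order all_algebra.
From mathcomp Require Import all_classical all_reals all_analysis.
From mathcomp Require Import ring lra zify.
Import numFieldNormedType.Exports.
Import Order.TTheory GRing.Theory Num.Theory.

(** Why the theorem holds.  Write [E N] for the minimal energy of [N] points of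
    the attractor [A] and [e N = E N / N ^ (1 + s / d)].  Only upper bounds of
    [E] are needed, because [e] turns out to be almost decreasing along the
    indices whose fractional parts of [log_M N] are close together.

    Since the pieces of [A] are at a positive distance from each other, copying
    a configuration of [N] points into the [M] pieces gives
    [E (M * N) <= M * r ^ (- s) * E N + K * (M * N) ^ 2]
    ([min_riesz_energy_copies]).  As [M * r ^ d = 1], the factor
    [M * r ^ (- s)] is exactly [M ^ (1 + s / d)], and as [s > d] the error is of
    lower order: up to a vanishing error, [e (M ^ k * N) <= e N].  Moreover
    a point can be adjoined to any configuration of [N] points at a cost
    [C * N ^ (s / d)] ([min_riesz_energy_step]): among the cells of a level that
    has at least [2 * N] of them, many contain no point of the configuration,
    and the average over these empty cells of the potential at a representative
    has this order.  Hence [e] changes little when [N] is multiplied by a number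
    close to [1].

    If [n >= N] and the fractional parts of [log_M n] and [log_M N] are close,
    then [n] is nearly [M ^ k * N] for some [k], and the two estimates give
    [e n <= e N + eta] for late [N] ([subscaling_almost_decreasing]).  Therefore
    along the indices whose fractional part tends to [a] the upper limit of [e]
    does not exceed its lower limit ([almost_decreasing_cvg]).  The limit [g a]
    depends on [a] only, and [g] is continuous because an index with fractional
    part near [b] has it near [a] when [a] and [b] are close
    ([near_limit_continuous]).

    The relation [M * r ^ d = 1] has to be extracted from the Hausdorff dimension
    ([hausdorff_dim_self_similar]).  The cells of a level are an economical cover
    of [A]; conversely, giving equal weights to the cells of a deep level shows
    that no cover is substantially more economical. *)

Set Implicit Arguments.
Unset Strict Implicit.
Unset Printing Implicit Defensive.

Local Open Scope classical_set_scope.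
Local Open Scope ring_scope.

(** * The Euclidean norm and similitudes *)

Section EuclideanNorm.
Context {R : realType} {p : nat}.
Implicit Types x y z : 'cV[R]_p.

Lemma sqr_euclid_norm x : euclid_norm x ^+ 2 = \sum_i x i ord0 ^+ 2.
Proof. by rewrite sqr_sqrtr// sumr_ge0// => i _; exact: sqr_ge0. Qed.

Lemma euclid_norm_ge0 x : 0 <= euclid_norm x.
Proof. exact: sqrtr_ge0. Qed.

Lemma euclid_normN x : euclid_norm (- x) = euclid_norm x.
Proof.
by congr Num.sqrt; apply: eq_bigr => i _; rewrite mxE sqrrN.
Qed.

Lemma euclid_distC x y : euclid_norm (x - y) = euclid_norm (y - x).
Proof. by rewrite -euclid_normN opprB. Qed.

Lemma euclid_norm0 : euclid_norm (0 : 'cV[R]_p) = 0.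
Proof.
rewrite /euclid_norm big1 ?sqrtr0// => i _.
by rewrite mxE expr0n.
Qed.

Lemma coord_le_euclid_norm x i : `|x i ord0| <= euclid_norm x.
Proof.
rewrite -[leLHS]sqrtr_sqr ler_sqrt; last first.
  by apply: sumr_ge0 => j _; exact: sqr_ge0.
rewrite (bigD1 i)//= lerDl; apply: sumr_ge0 => j _; exact: sqr_ge0.
Qed.

Lemma euclid_norm_eq0 x : euclid_norm x = 0 -> x = 0.
Proof.
move=> x0; apply/matrixP => i j; rewrite ord1 mxE.
by have := coord_le_euclid_norm x i; rewrite x0 normr_le0 => /eqP.
Qed.

(** By Lagrange's identity, the defect of the squared inequality is half of the
    sum of the squares of the minors [x i * y j - x j * y i]. *)
Lemma euclid_cauchy_schwarz x y :
  \sum_i x i ord0 * y i ord0 <= euclid_norm x * euclid_norm y.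
Proof.
apply: le_trans (ler_norm _) _.
rewrite -[leLHS]sqrtr_sqr -sqrtrM; last first.
  by apply: sumr_ge0 => i _; exact: sqr_ge0.
apply: ler_wsqrtr.
have : 0 <= \sum_i \sum_j (x i ord0 * y j ord0 - x j ord0 * y i ord0) ^+ 2.
  by apply: sumr_ge0 => i _; apply: sumr_ge0 => j _; exact: sqr_ge0.
have -> : \sum_i \sum_j (x i ord0 * y j ord0 - x j ord0 * y i ord0) ^+ 2 =
    \sum_i \sum_j (x i ord0 ^+ 2 * y j ord0 ^+ 2) +
    \sum_i \sum_j (x j ord0 ^+ 2 * y i ord0 ^+ 2) -
    \sum_i \sum_j ((x i ord0 * y i ord0) * (x j ord0 * y j ord0)) *+ 2.
  rewrite -big_split -sumrB; apply: eq_bigr => i _ /=.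
  by rewrite -big_split -sumrB; apply: eq_bigr => j _ /=; ring.
rewrite (exchange_big _ _ _ _ _ (fun i j => x j ord0 ^+ 2 * y i ord0 ^+ 2)) /=.
under [X in _ - X]eq_bigr do rewrite sumrMnl.
rewrite sumrMnl -!big_distrlr /= expr2.
move: (_ * _) (_ * _) => u v; rewrite mulr2n; lra.
Qed.

Lemma euclid_normD x y : euclid_norm (x + y) <= euclid_norm x + euclid_norm y.
Proof.
rewrite -(@ler_pXn2r _ 2)// ?nnegrE ?addr_ge0 ?euclid_norm_ge0//.
rewrite sqr_euclid_norm sqrrD !sqr_euclid_norm.
have -> : \sum_i (x + y) i ord0 ^+ 2 = \sum_i x i ord0 ^+ 2 +
    (\sum_i x i ord0 * y i ord0) *+ 2 + \sum_i y i ord0 ^+ 2.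
  rewrite -sumrMnl -!big_split; apply: eq_bigr => i _ /=.
  by rewrite mxE sqrrD.
by rewrite lerD2r lerD2l lerMn2r euclid_cauchy_schwarz orbT.
Qed.

Lemma mx_norm_le_euclid_norm x : `|x| <= euclid_norm x.
Proof.
rewrite [leLHS]mx_normrE; apply/bigmax_leP; split; first exact: euclid_norm_ge0.
by move=> [i j] _ /=; rewrite ord1 coord_le_euclid_norm.
Qed.

Lemma euclid_norm_le_mx_norm x : euclid_norm x <= p%:R * `|x|.
Proof.
have coord i : `|x i ord0| <= `|x|.
  by rewrite [leRHS]mx_normrE; apply: (le_bigmax _ _ (i, ord0)).
rewrite -(@ler_pXn2r _ 2)// ?nnegrE ?mulr_ge0 ?euclid_norm_ge0//.
rewrite sqr_euclid_norm.
apply: (@le_trans _ _ (\sum_(i < p) `|x| ^+ 2)).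
  by apply: ler_sum => i _; rewrite -[leLHS]real_normK ?num_real// lerXn2r
    ?nnegrE.
rewrite sumr_const card_ord exprMn -[leLHS]mulr_natl ler_wpM2r ?sqr_ge0//.
rewrite expr2; case: p => [|n]; first by rewrite mul0r.
by rewrite ler_peMr// ler1n.
Qed.

Lemma euclid_norm_isometry (O : 'M[R]_p) x :
  O^T *m O = 1%:M -> euclid_norm (O *m x) = euclid_norm x.
Proof.
have dotE (z : 'cV[R]_p) : \sum_i z i ord0 ^+ 2 = (z^T *m z) ord0 ord0.
  by rewrite mxE; apply: eq_bigr => i _; rewrite mxE expr2.
move=> OO; congr Num.sqrt; rewrite !dotE trmx_mul -mulmxA [X in _ *m X]mulmxA.
by rewrite OO mul1mx.
Qed.

Lemma similitude_dist (r : R) (f : 'cV[R]_p -> 'cV[R]_p) x y :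
  similitude r f -> euclid_norm (f x - f y) = r * euclid_norm (x - y).
Proof.
move=> [/andP[r0 _] [Q [z [QQ fE]]]].
rewrite !fE opprD addrACA subrr addr0 -scalerBr -mulmxBr.
rewrite -[in RHS](euclid_norm_isometry _ QQ) /euclid_norm.
under eq_bigr do rewrite mxE exprMn.
by rewrite -mulr_sumr sqrtrM ?sqr_ge0// sqrtr_sqr gtr0_norm.
Qed.

Lemma similitude_inj (r : R) (f : 'cV[R]_p -> 'cV[R]_p) :
  similitude r f -> injective f.
Proof.
move=> fr x y fxy; have := similitude_dist x y fr.
have [/andP[r0 _] _] := fr.
rewrite fxy subrr euclid_norm0 => /esym/eqP; rewrite mulf_eq0 (gt_eqF r0)/=.
by move=> /eqP/euclid_norm_eq0/eqP; rewrite subr_eq0 => /eqP.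
Qed.

Lemma similitude_continuous (r : R) (f : 'cV[R]_p -> 'cV[R]_p) :
  similitude r f -> continuous f.
Proof.
move=> fr x; have [/andP[r0 _] _] := fr.
move=> U /nbhs_ballP[e /= e0 eU].
have k0 : 0 < r * p.+1%:R by rewrite mulr_gt0// ltr0n.
apply/nbhs_ballP; exists (e / (r * p.+1%:R)) => /=; first exact: divr_gt0.
move=> y; rewrite -ball_normE /= => xy.
apply: eU; rewrite -ball_normE /=.
apply: le_lt_trans (mx_norm_le_euclid_norm _) _.
rewrite (similitude_dist _ _ fr).
apply: (@le_lt_trans _ _ (r * p.+1%:R * `|x - y|)).
  rewrite -mulrA ler_pM2l//; apply: le_trans (euclid_norm_le_mx_norm _) _.
  by rewrite ler_wpM2r// ler_nat.
by rewrite mulrC -ltr_pdivlMr.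
Qed.

End EuclideanNorm.

(** * Separation of the pieces *)

Section SelfSimilar.
Context {R : realType} {p M : nat} {r : R} {psi : 'I_M -> 'cV[R]_p -> 'cV[R]_p}
  {A : set 'cV[R]_p}.
Hypothesis hA : self_similar_fractal (fun _ : 'I_M => r) psi A.

Lemma copies_ge2 : (2 <= M)%N.
Proof. by case: hA. Qed.

Lemma ratio_gt0 : 0 < r.
Proof.
case: hA => M2 _ /(_ (Ordinal (ltnW M2)))[/andP[]//].
Qed.

Lemma ratio_lt1 : r < 1.
Proof.
case: hA => M2 _ /(_ (Ordinal (ltnW M2)))[/andP[]//].
Qed.

Lemma piece_dist m x y :
  euclid_norm (psi m x - psi m y) = r * euclid_norm (x - y).
Proof. by case: hA => _ _ /(_ m) + _ _; exact: similitude_dist. Qed.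

Lemma piece_inj m : injective (psi m).
Proof. by case: hA => _ _ /(_ m) + _ _; exact: similitude_inj. Qed.

Lemma piece_sub m x : A x -> A (psi m x).
Proof. by case: hA => _ _ _ AE _ Ax; rewrite AE; exists m => //; exists x. Qed.

Lemma piece_cover x : A x -> exists m y, A y /\ x = psi m y.
Proof.
case: hA => _ _ _ AE _; rewrite [in X in X -> _]AE => -[m _ [y Ay <-]].
by exists m, y.
Qed.

(** The pieces are disjoint compact sets, so [0] is not in the compact set of
    the differences of points of two different pieces. *)
Lemma piece_gap : exists2 gap : R, 0 < gap &
  forall m m' x y, m != m' -> A x -> A y ->
    gap <= euclid_norm (psi m x - psi m' y).
Proof.
case: hA => M2 [_ cA] sim _ dis.
have cont m : continuous (psi m) by exact: similitude_continuous (sim m).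
pose far (ij : 'I_M * 'I_M) : set 'cV[R]_p := [set z | ij.1 != ij.2 ->
  forall x y, A x -> A y -> z <> psi ij.1 x - psi ij.2 y].
have nfar ij : \forall z \near (0 : 'cV[R]_p), far ij z.
  have [eij|nij] := eqVneq ij.1 ij.2.
    by apply: filterE => z; rewrite /far /= eij eqxx.
  pose D := [set u.1 - u.2 | u in (psi ij.1 @` A) `*` (psi ij.2 @` A)].
  have cD : compact D.
    have cpiece m : compact (psi m @` A).
      exact: continuous_compact (continuous_subspaceT (cont m)) cA.
    apply: continuous_compact (compact_setX (cpiece _) (cpiece _)).
    apply: continuous_subspaceT => u.
    by apply: (@cvgB _ 'cV[R]_p); [exact: cvg_fst | exact: cvg_snd].
  have : open (~` D) by apply: closed_openC; exact: compact_closed cD.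
  rewrite openE => /(_ 0)/=; rewrite /interior => /(_ _)/filterS; apply.
    move=> z nD _ x y Ax Ay zE; apply: nD; exists (psi ij.1 x, psi ij.2 y) => //.
    by split; [exists x | exists y].
  move=> [[u v] /= [[x Ax xu] [y Ay yv]] /eqP]; rewrite subr_eq0 => /eqP uv.
  have /trivIsetP/(_ ij.1 ij.2 I I nij) := dis.
  move=> /seteqP[+ _] => /(_ (psi ij.1 x))/=; apply; split; first by exists x.
  by rewrite xu uv -yv; exists y.
have : nbhs (0 : 'cV[R]_p) [set z | forall ij, far ij z].
  exact: filter_forall nfar.
move=> /nbhs_ballP[e /= e0 He].
exists e => // m m' x y mm' Ax Ay; rewrite leNgt; apply/negP => lte.
have : ball (0 : 'cV[R]_p) e (psi m x - psi m' y).
  rewrite -ball_normE /= sub0r normrN.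
  exact: le_lt_trans (mx_norm_le_euclid_norm _) lte.
by move=> /He/(_ (m, m') mm' x y Ax Ay); apply.
Qed.

Lemma attractor_diameter : exists2 D : R, 0 < D &
  forall x y, A x -> A y -> euclid_norm (x - y) <= D.
Proof.
case: hA => _ [_ /compact_bounded[B [_ /(_ (`|B| + 1))hB]]] _ _ _.
have {}hB : forall x, A x -> `|x| <= `|B| + 1.
  by apply: hB; rewrite (le_lt_trans (ler_norm B))// ltrDl.
exists (p%:R * (`|B| + 1 + (`|B| + 1)) + 1) => [|x y Ax Ay].
  by rewrite ltr_wpDl// mulr_ge0// !addr_ge0.
apply: le_trans (euclid_norm_le_mx_norm _) _.
rewrite ler_wpDr// ler_wpM2l//.
by apply: le_trans (ler_normB _ _) _; rewrite lerD ?hB.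
Qed.

End SelfSimilar.

(** * Cells *)

(** An address of length [k] codes a composition of [k] of the similitudes; the
    images of the attractor under these are the cells of level [k]. *)
Fixpoint address (M k : nat) : finType :=
  if k is k'.+1 then ('I_M * address M k')%type else unit.

Lemma card_address M k : #|{: address M k}| = (M ^ k)%N.
Proof.
elim: k => [|k IH]; first by rewrite card_unit.
by rewrite /= card_prod card_ord IH expnS.
Qed.

Fixpoint cell_map (T : Type) (M k : nat) (psi : 'I_M -> T -> T) :
    address M k -> T -> T :=
  if k is k'.+1 then fun w x => psi w.1 (cell_map psi w.2 x) else fun _ => id.

Section Cells.
Context {R : realType} {p M : nat} {r : R} {psi : 'I_M -> 'cV[R]_p -> 'cV[R]_p}
  {A : set 'cV[R]_p}.
Hypothesis hA : self_similar_fractal (fun _ : 'I_M => r) psi A.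

Lemma cell_map_sub k (w : address M k) x : A x -> A (cell_map psi w x).
Proof.
by move=> Ax; elim: k w => //= k IH w; apply: (piece_sub hA); exact: IH.
Qed.

Lemma cell_map_dist k (w : address M k) x y :
  euclid_norm (cell_map psi w x - cell_map psi w y) =
  r ^+ k * euclid_norm (x - y).
Proof.
elim: k w => [|k IH] w /=; first by rewrite mul1r.
by rewrite (piece_dist hA) IH exprS mulrA.
Qed.

Lemma cell_cover k x : A x -> exists w : address M k,
  exists2 y, A y & x = cell_map psi w y.
Proof.
elim: k x => [|k IH] x Ax; first by exists tt, x.
have [m [y [Ay ->]]] := piece_cover hA Ax.
by have [w [z Az ->]] := IH _ Ay; exists (m, w), z.
Qed.

(** A set whose points are closer to each other than the gaps of the first [j]
    levels meets a single cell of level [j], which has a proportion [M ^- j] of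
    the cells of each deeper level. *)
Lemma card_cells_meeting (gap : R) x0 : A x0 ->
  (forall m m' x y, m != m' -> A x -> A y ->
    gap <= euclid_norm (psi m x - psi m' y)) ->
  forall j l (U : set 'cV[R]_p), (j <= l)%N ->
  (forall x y, A x -> A y -> U x -> U y -> forall i, (i < j)%N ->
    euclid_norm (x - y) < gap * r ^+ i) ->
  (#|[set w : address M l | `[< U (cell_map psi w x0) >]]%SET| * M ^ j
    <= M ^ l)%N.
Proof.
move=> Ax0 hgap; elim=> [|j IH] l U jl Usmall.
  by rewrite muln1 -card_address max_card.
case: l jl => // l jl.
have [Uw|noU] := pselect (exists w : address M l.+1, U (cell_map psi w x0));
    last first.
  rewrite (_ : [set _ | _]%SET = finset.set0) ?cards0//.
  apply/setP => w; rewrite !inE; apply/negbTE/negP => /asboolP Uw.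
  by apply: noU; exists w.
have [[m0 w0] /= Uw0] := Uw.
pose V := [set x | U (psi m0 x)].
have single m (w : address M l) : U (psi m (cell_map psi w x0)) -> m = m0.
  move=> Um; apply/eqP/negP => /negP mm0.
  have := hgap _ _ _ _ mm0 (cell_map_sub w Ax0) (cell_map_sub w0 Ax0).
  rewrite leNgt -[gap]mulr1 -[1](expr0 r) Usmall//.
  - by apply: (piece_sub hA); exact: cell_map_sub.
  - by apply: (piece_sub hA); exact: cell_map_sub.
have subV : ([set w : address M l.+1 | `[< U (cell_map psi w x0) >]] \subset
    [set (m0, w) | w in [set w : address M l | `[< V (cell_map psi w x0) >]]])%SET.
  apply/fintype.subsetP => -[m w]; rewrite inE => /asboolP/= Umw.
  have mm0 := single _ _ Umw; rewrite mm0 in Umw *.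
  by apply/imsetP; exists w => //; rewrite inE; apply/asboolP.
rewrite !expnS mulnCA leq_mul2l; apply/orP; right.
apply: leq_trans (IH l V jl _).
  rewrite leq_mul2r; apply/orP; right.
  by apply: leq_trans (subset_leq_card subV) _; exact: leq_imset_card.
move=> x y Ax Ay Vx Vy i ij.
have := Usmall _ _ (piece_sub hA m0 Ax) (piece_sub hA m0 Ay) Vx Vy i.+1 ij.
by rewrite (piece_dist hA) exprS mulrCA ltr_pM2l// (ratio_gt0 hA).
Qed.

End Cells.

(** * Hausdorff dimension of the attractor *)

Lemma expr_small (R : realType) (z e : R) : 0 <= z < 1 -> 0 < e ->
  exists k0, forall k, (k0 <= k)%N -> z ^+ k < e.
Proof.
move=> /andP[z0 z1] e0.
have /cvg_expr : `|z| < 1 by rewrite ger0_norm.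
move=> /cvgrPdist_lt/(_ e e0)[k0 _ Hk]; exists k0 => k kk0.
by have := Hk k kk0; rewrite /= sub0r normrN ger0_norm ?exprn_ge0.
Qed.

Section Diameter.
Context {R : realType} {p : nat}.
Implicit Types U : set 'cV[R]_p.

Lemma diameter_ge0 U : (0 <= diameter U)%E.
Proof. by apply: ereal_sup_ubound; left. Qed.

Lemma dist_le_diameter U x y :
  U x -> U y -> ((euclid_norm (x - y))%:E <= diameter U)%E.
Proof. by move=> Ux Uy; apply: ereal_sup_ubound; right; exists x => //; exists y. Qed.

Lemma diameter_le U (c : R) : 0 <= c ->
  (forall x y, U x -> U y -> euclid_norm (x - y) <= c) ->
  (diameter U <= c%:E)%E.
Proof.
move=> c0 Uc; apply: ge_ereal_sup => _ [->|[x Ux [y Uy <-]]].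
  by rewrite lee_fin.
by rewrite lee_fin Uc.
Qed.

Lemma diameter_set0 : diameter (@set0 'cV[R]_p) = 0%E.
Proof.
by apply/eqP; rewrite eq_le diameter_ge0 andbT; exact: diameter_le.
Qed.

End Diameter.

Section HausdorffDimension.
Context {R : realType} {p M : nat} {r : R} {psi : 'I_M -> 'cV[R]_p -> 'cV[R]_p}
  {A : set 'cV[R]_p}.
Hypothesis hA : self_similar_fractal (fun _ : 'I_M => r) psi A.
Implicit Types t : R.

Lemma hausdorff_premeasure_ge0 t delta (B : set 'cV[R]_p) :
  (0 <= hausdorff_premeasure t delta B)%E.
Proof.
apply: le_ereal_inf_tmp => _ [U _ <-].
by apply: nneseries_ge0 => i _ _; exact: poweR_ge0.
Qed.

(** The cells of level [k] have diameter at most [D * r ^+ k], and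
    [M ^ k * (D * r ^+ k) ^ t] tends to [0]. *)
Lemma hausdorff_measure_self_similar_eq0 t : 0 < t -> M%:R * r `^ t < 1 ->
  hausdorff_measure t A = 0%E.
Proof.
move=> t0 Mrt; apply/eqP; rewrite eq_le; apply/andP; split; last first.
  apply: le_trans (hausdorff_premeasure_ge0 t 1 A) _.
  by apply: ereal_sup_ubound; exists 1 => //=.
apply: ge_ereal_sup => _ [delta /= delta0 <-].
apply/lee_addgt0Pr => e e0; rewrite add0e.
have [D D0 hD] := attractor_diameter hA.
have r0 := ratio_gt0 hA; have r1 := ratio_lt1 hA.
have [k1 hk1] : exists k0, forall k, (k0 <= k)%N -> r ^+ k < delta / D.
  by apply: expr_small; rewrite ?divr_gt0// ltW.
have [k2 hk2] : exists k0, forall k, (k0 <= k)%N ->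
    (M%:R * r `^ t) ^+ k < e / D `^ t.
  by apply: expr_small; rewrite ?divr_gt0 ?powR_gt0// mulr_ge0 ?powR_ge0.
pose k := maxn k1 k2.
pose c := D * r ^+ k.
have c0 : 0 <= c by rewrite mulr_ge0 ?exprn_ge0// ltW.
pose U (i : nat) : set 'cV[R]_p := [set x | exists w : address M k,
  nat_of_ord (enum_rank w) = i /\ (cell_map psi w @` A) x].
have Udiam i : (diameter (U i) <= c%:E)%E.
  apply: diameter_le => // x y [w [wi [x' Ax' <-]]] [w' [wi' [y' Ay' <-]]].
  have <- : w = w' by apply: enum_rank_inj; apply: val_inj; rewrite /= wi wi'.
  by rewrite (cell_map_dist hA) mulrC ler_wpM2r ?hD// exprn_ge0// ltW.
have Utail i : (M ^ k <= i)%N -> U i = set0.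
  move=> ik; apply/seteqP; split=> // x [w [wi _]].
  by have := ltn_ord (enum_rank w); rewrite wi card_address ltnNge ik.
have Ucover : A `<=` \bigcup_i U i.
  move=> x /(cell_cover hA k)[w [y Ay xE]].
  by exists (enum_rank w : nat) => //; exists w; split=> //; exists y.
apply: (@le_trans _ _ (\sum_(0 <= i <oo) poweR (diameter (U i)) t)%E).
  apply: ereal_inf_lbound; exists U => //; split=> // i.
  apply: le_trans (Udiam i) _; rewrite lee_fin /c mulrC -ler_pdivlMr//.
  by apply/ltW/hk1; exact: leq_maxl.
rewrite (@nneseries_split _ _ 0 (M ^ k)) => [|i _]; last exact: poweR_ge0.
rewrite add0n [X in (_ + X)%E]eseries0 ?adde0 => [|i ik _]; last first.
  by rewrite Utail// diameter_set0 poweR0r// gt_eqF.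
apply: (@le_trans _ _ (\sum_(0 <= i < M ^ k) (c `^ t)%:E)%E).
  apply: lee_sum => i _; rewrite -poweR_EFin.
  apply: gt0_ler_poweR; rewrite ?(ltW t0)// in_itv/= leey andbT ?lee_fin//.
  exact: diameter_ge0.
rewrite sumEFin lee_fin big_const_nat subn0 iter_addr_0.
rewrite -mulr_natr mulrC powRM ?exprn_ge0 ?(ltW D0) ?(ltW r0)//.
rewrite -powR_mulrn ?(ltW r0)// -powRrM [k%:R * t]mulrC powRrM powR_mulrn ?powR_ge0//.
rewrite natrX mulrCA -exprMn mulrC -ler_pdivlMr ?powR_gt0//.
by apply/ltW/hk2; exact: leq_maxr.
Qed.

End HausdorffDimension.

Lemma compact_finite_subcover (T : ptopologicalType) (B : set T)
    (V : nat -> set T) : compact B -> (forall i, open (V i)) ->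
  B `<=` \bigcup_i V i -> exists n, forall x, B x -> exists i : 'I_n, V i x.
Proof.
rewrite compact_cover => cB oV BV.
have [F _ BF] := cB nat setT V (fun i _ => oV i) BV.
exists (\max_(i <- finmap.enum_fset F) i.+1)%N => x /BF[i /= iF Vix].
by exists (Ordinal (@leq_bigmax_seq _ (finmap.enum_fset F) xpredT succn i iF isT)).
Qed.

Lemma card_cover_leq_sum (T : finType) (n : nat) (S : 'I_n -> {set T}) :
  (forall w, exists i, w \in S i) -> (#|T| <= \sum_(i < n) #|S i|)%N.
Proof.
move=> cov; rewrite -cardsT (_ : [set: T]%SET = (\bigcup_i S i)%SET).
  elim/big_ind2: _ => [|A a B b Aa Bb|//]; first by rewrite cards0.
  by rewrite cardsU (leq_trans (leq_subr _ _))// leq_add.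
apply/setP => w; rewrite inE; apply/esym/finset.bigcupP.
by have [i wi] := cov w; exists i.
Qed.

Section HausdorffDimensionLower.
Context {R : realType} {p M : nat} {r : R} {psi : 'I_M -> 'cV[R]_p -> 'cV[R]_p}
  {A : set 'cV[R]_p}.
Hypothesis hA : self_similar_fractal (fun _ : 'I_M => r) psi A.
Implicit Types t : R.

(** Take the deepest level at which the gaps exceed the diameter [D].  There is
    none if [D = 0]; the margin [e] covers this case, in which any sufficiently
    deep level will do. *)
Lemma level_of_diameter (gap t D e : R) : 0 < gap -> 0 < t ->
  1 <= M%:R * r `^ t -> 0 <= D < gap -> 0 < e ->
  exists j, D < gap * r ^+ j /\ (M ^ j.+1)%:R^-1 <= (D / gap) `^ t + e.
Proof.
move=> gap0 t0 Mrt /andP[D0 Dgap] e0.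
have r0 := ratio_gt0 hA; have r1 := ratio_lt1 hA.
have M0 : 0 < M%:R :> R by rewrite ltr0n (ltnW (copies_ge2 hA)).
have Mr j : (M ^ j)%:R^-1 <= (r ^+ j) `^ t.
  rewrite -powR_mulrn ?(ltW r0)// -powRrM [_ * t]mulrC powRrM powR_mulrn ?powR_ge0//.
  rewrite -[leLHS]mul1r ler_pdivrMr ?ltr0n ?expn_gt0 ?(ltnW (copies_ge2 hA))//.
  by rewrite natrX -exprMn mulrC exprn_ege1.
have [j0 hj0] : exists k0, forall k, (k0 <= k)%N -> (r `^ t) ^+ k < e.
  apply: expr_small => //; rewrite powR_ge0/=.
  have : r `^ t < 1 `^ t by rewrite gt0_ltr_powR ?nnegrE// ltW.
  by rewrite powR1.
have [small|big] := ltP D (gap * r ^+ j0.+1).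
  exists j0.+1; split=> //; apply: le_trans (Mr _) _.
  rewrite ler_wpDl ?powR_ge0// -powR_mulrn ?(ltW r0)// -powRrM mulrC powRrM.
  by rewrite powR_mulrn ?powR_ge0// ltW// hj0// -addn2 leq_addr.
have exn : exists n, gap * r ^+ n <= D by exists j0.+1.
case: (ex_minnP exn) => -[|j] hj minj.
  by move: hj; rewrite mulr1 leNgt Dgap.
exists j; split.
  by rewrite ltNge; apply/negP => /minj; rewrite ltnn.
apply: le_trans (Mr _) _; rewrite ler_wpDr// ?(ltW e0)//.
rewrite ge0_ler_powR ?nnegrE ?exprn_ge0 ?divr_ge0 ?(ltW t0) ?(ltW gap0) ?(ltW r0)//.
by rewrite ler_pdivlMr// mulrC.
Qed.

(** Mass distribution: cells of a deep level have equal weights.  A set of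
    diameter [D] meets a proportion of them of order [D ^ t], so the sets of a
    cover must satisfy [\sum D ^ t >= gap ^ t / 2].  Compactness makes the cover
    finite, so that one deep level serves all its sets. *)
Lemma hausdorff_measure_self_similar_neq0 t : 0 < t -> 1 <= M%:R * r `^ t ->
  hausdorff_measure t A <> 0%E.
Proof.
move=> t0 Mrt H0; have [_ [[x0 Ax0] cA] _ _ _] := hA.
have r0 := ratio_gt0 hA; have r1 := ratio_lt1 hA.
have [gap gap0 hgap] := piece_gap hA.
have c0 : 0 < gap `^ t / 2 by rewrite divr_gt0 ?powR_gt0.
have : (hausdorff_premeasure t (gap / 2) A < (gap `^ t / 2)%:E)%E.
  apply: (@le_lt_trans _ _ 0%E); last by rewrite lte_fin.
  rewrite -H0; apply: ereal_sup_ubound; exists (gap / 2) => //=.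
  exact: divr_gt0.
move=> /ereal_inf_lt[_ [U [Ucover Usmall] <-] Usum].
pose D i := fine (diameter (U i)).
have DE i : diameter (U i) = (D i)%:E.
  by rewrite fineK// ge0_fin_numE ?diameter_ge0// (le_lt_trans (Usmall i))// ltry.
have D0 i : 0 <= D i by rewrite fine_ge0 ?diameter_ge0.
have Dgap i : D i < gap.
  have := Usmall i; rewrite DE lee_fin => /le_lt_trans; apply.
  by rewrite gtr_pMr// invf_lt1// ltr1n.
pose e i : R := (1 / 2) ^+ i.+2.
have /choice[j hj] : forall i, exists j, D i < gap * r ^+ j /\
    (M ^ j.+1)%:R^-1 <= (D i / gap) `^ t + e i.
  move=> i; apply: level_of_diameter; rewrite ?D0 ?Dgap//.
  by rewrite exprn_gt0.
(* thickening [U i] by [h i] makes it open, but keeps its diameter below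
   [gap * r ^+ j i]; the factor [p.+1] compares the two norms *)
pose h i := (gap * r ^+ j i - D i) / (2 * p.+1%:R).
have h0 i : 0 < h i by rewrite divr_gt0 ?subr_gt0 ?mulr_gt0 ?ltr0n//; case: (hj i).
pose V i := \bigcup_(y in U i) ball y (h i).
have Vopen i : open (V i) by apply: bigcup_open => y _; exact: ball_open.
have Vcover : A `<=` \bigcup_i V i.
  move=> x /Ucover[i _ Uix]; exists i => //; exists x => //; exact: ballxx.
have Vsmall i x y : V i x -> V i y -> euclid_norm (x - y) < gap * r ^+ j i.
  move=> [u Uu]; rewrite -ball_normE /= => ux [v Uv]; rewrite -ball_normE /= => vy.
  have near (a b : 'cV[R]_p) : `|a - b| < h i ->
      euclid_norm (a - b) <= p%:R * h i.
    move=> /ltW ab; apply: le_trans (euclid_norm_le_mx_norm _) _.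
    by rewrite ler_wpM2l.
  have uvD : euclid_norm (u - v) <= D i by rewrite -lee_fin -DE dist_le_diameter.
  have -> : x - y = (x - u) + ((u - v) + (v - y)) by rewrite !addrA !subrK.
  apply: le_lt_trans (euclid_normD _ _) _.
  apply: le_lt_trans (lerD (lexx _) (euclid_normD _ _)) _.
  apply: le_lt_trans (lerD _ (lerD uvD (near _ _ vy))) _.
    by rewrite euclid_distC; apply: near.
  have : p%:R * h i * 2 < gap * r ^+ j i - D i.
    rewrite -(@divfK _ (2 * p.+1%:R) _ (gap * _ - _)); last first.
      by rewrite mulf_neq0 ?pnatr_eq0.
    rewrite -/(h i) -natr1; have := h0 i; lra.
  move: (p%:R * h i) => a; lra.
have [n hn] := compact_finite_subcover cA Vopen Vcover.
pose l := \max_(i < n) (j i).+1.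
pose S (i : 'I_n) := [set w : address M l | `[< V i (cell_map psi w x0) >]]%SET.
have cardS i : (#|S i| * M ^ (j i).+1 <= M ^ l)%N.
  apply: (card_cells_meeting hA Ax0 hgap); first exact: (leq_bigmax i).
  move=> x y _ _ Vx Vy i' ij; apply: lt_le_trans (Vsmall _ _ _ Vx Vy) _.
  by rewrite ler_pM2l// ler_wiXn2l// ltW.
have Scover w : exists i, w \in S i.
  have [i Vi] := hn _ (cell_map_sub hA w Ax0).
  by exists i; rewrite inE; apply/asboolP.
have M0 k : 0 < (M ^ k)%:R :> R by rewrite ltr0n expn_gt0 (ltnW (copies_ge2 hA)).
have : (M ^ l)%:R <= \sum_(i < n) #|S i|%:R :> R.
  by rewrite -natr_sum ler_nat -[X in (X <= _)%N](card_address M l) card_cover_leq_sum.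
apply/negP; rewrite -ltNge.
apply: (@le_lt_trans _ _ (\sum_(i < n) (M ^ l)%:R * ((D i / gap) `^ t + e i))).
  apply: ler_sum => i _; apply: (@le_trans _ _ ((M ^ l)%:R * (M ^ (j i).+1)%:R^-1)).
    by rewrite ler_pdivlMr// -natrM ler_nat.
  by rewrite ler_pM2l//; case: (hj i).
rewrite -mulr_sumr gtr_pMr// big_split /=.
have sume : \sum_(i < n) e i <= 1 / 2.
  suff -> : \sum_(i < n) e i = 1 / 2 - (1 / 2) ^+ n.+1.
    by rewrite gerBl exprn_ge0.
  elim: n {hn l S cardS Scover} => [|n IH]; first by rewrite big_ord0 expr1 subrr.
  rewrite big_ord_recr /= IH /e !exprS; move: (_ ^+ n) => a; lra.
suff : \sum_(i < n) (D i / gap) `^ t < 1 / 2 by move: sume; lra.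
have -> : \sum_(i < n) (D i / gap) `^ t = (\sum_(i < n) D i `^ t) / gap `^ t.
  rewrite mulr_suml; apply: eq_bigr => i _.
  by rewrite powRM ?invr_ge0 ?(ltW gap0)// -powR_inv1 ?(ltW gap0)// -powRrM
    mulN1r powRN.
rewrite ltr_pdivrMr ?powR_gt0// mul1r [ltRHS]mulrC -lte_fin.
apply: le_lt_trans Usum; rewrite -sumEFin.
under eq_bigr do rewrite -poweR_EFin -DE.
rewrite -(big_mkord xpredT (fun i => poweR (diameter (U i)) t)).
by apply: nneseries_lim_ge => i _ _; exact: poweR_ge0.
Qed.

(** The product [M * r ^ t] decreases in [t] and equals [1] at
    [t = ln M / - ln r]. *)
Theorem hausdorff_dim_self_similar :
  hausdorff_dim A = (ln M%:R / - ln r)%:E.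
Proof.
have r0 := ratio_gt0 hA; have r1 := ratio_lt1 hA; have M2 := copies_ge2 hA.
have lr : 0 < - ln r by rewrite oppr_gt0 ln_lt0// r0.
have M0 : 0 < M%:R :> R by rewrite ltr0n ltnW.
have lM : 0 < ln (M%:R : R) by rewrite ln_gt0// ltr1n.
have Mr t : M%:R * r `^ t = expR (ln M%:R + t * ln r).
  by rewrite expRD lnK ?posrE// /powR gt_eqF.
apply/eqP; rewrite eq_le; apply/andP; split.
  apply/lee_addgt0Pr => e e0; rewrite -EFinD.
  apply: ereal_inf_lbound; exists (ln M%:R / - ln r + e) => //.
  have d0 : 0 < ln M%:R / - ln r + e by rewrite addr_gt0 ?divr_gt0.
  split=> //; apply: (hausdorff_measure_self_similar_eq0 hA) => //.
    rewrite Mr -[ltRHS]expR0 ltr_expR mulrDl invrN mulrN mulNr divfK; last first.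
    by rewrite lt_eqF// -oppr_gt0.
  by rewrite addrA subrr add0r pmulr_rlt0// -oppr_gt0.
apply: le_ereal_inf_tmp => _ [t [t0 Ht] <-].
rewrite lee_fin leNgt; apply/negP => td.
suff Mrt : 1 <= M%:R * r `^ t.
  exact: (hausdorff_measure_self_similar_neq0 t0 Mrt Ht).
rewrite Mr -[leLHS]expR0 ler_expR; move: td; rewrite ltr_pdivlMr// mulrN.
by rewrite -subr_gt0 opprK => /ltW.
Qed.

End HausdorffDimensionLower.

(** * Riesz energy *)

Lemma gt1_ltr_powR (R : realType) (a x y : R) : 1 < a -> x < y -> a `^ x < a `^ y.
Proof.
move=> a1 xy; have a0 := lt_trans ltr01 a1.
by rewrite /powR gt_eqF// ltr_expR ltr_pM2r ?ln_gt0.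
Qed.

Section RieszEnergy.
Context {R : realType} {p : nat}.
Implicit Types (s : R) (A : set 'cV[R]_p).

(** Arbitrary finite index types are convenient: products index the copies of
    a configuration in the pieces, and sums index an adjoined point. *)
Definition energy_of s (I : finType) (x : I -> 'cV[R]_p) : R :=
  \sum_i \sum_(j | i != j) euclid_norm (x i - x j) `^ (- s).

Definition config A (I : finType) (x : I -> 'cV[R]_p) : Prop :=
  injective x /\ forall i, A (x i).

Lemma energy_of_ge0 s (I : finType) (x : I -> 'cV[R]_p) : 0 <= energy_of s x.
Proof. by apply: sumr_ge0 => i _; apply: sumr_ge0 => j _; exact: powR_ge0. Qed.

Lemma min_riesz_energy_ge0 s A N : 0 <= min_riesz_energy s A N.
Proof.
rewrite /min_riesz_energy; set E := [set _ | _ in _].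
have [->|/set0P E0] := eqVneq E set0; first by rewrite inf0.
by apply: lb_le_inf => // _ [x _ <-]; exact: energy_of_ge0.
Qed.

Lemma min_riesz_energy_le s A N (I : finType) (x : I -> 'cV[R]_p) :
  #|I| = N -> config A x -> min_riesz_energy s A N <= energy_of s x.
Proof.
move=> <- [xinj Ax].
apply: ge_inf; first by exists 0 => _ [y _ <-]; exact: energy_of_ge0.
exists (x \o enum_val); first by split=> [i j /xinj/enum_val_inj|i //=].
have bij : {on [pred _ : I | true], bijective (@enum_val I I)}.
  exact/onW_bij/enum_val_bij.
rewrite /energy_of /riesz_energy [RHS](reindex _ bij); apply: eq_bigr => i _ /=.
rewrite [RHS](reindex _ (onW_bij _ (enum_val_bij I))); apply: eq_bigl => j /=.
by rewrite (inj_eq enum_val_inj).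
Qed.

Lemma le_min_riesz_energy s A N (y a c : R) : 0 < a ->
  (exists x : 'I_N -> 'cV[R]_p, config A x) ->
  (forall x : 'I_N -> 'cV[R]_p, config A x -> y <= a * energy_of s x + c) ->
  y <= a * min_riesz_energy s A N + c.
Proof.
move=> a0 [x0 Ax0] H; rewrite -lerBlDr mulrC -ler_pdivrMr//.
apply: lb_le_inf; first by exists (riesz_energy s x0), x0.
by move=> _ [x Ax <-]; rewrite ler_pdivrMr// mulrC lerBlDr; exact: H.
Qed.

Lemma min_riesz_energy_mono s A n N : (n <= N)%N ->
  (exists x : 'I_N -> 'cV[R]_p, config A x) ->
  min_riesz_energy s A n <= min_riesz_energy s A N.
Proof.
move=> nN exN; rewrite -[leRHS]mul1r -[leRHS]addr0.
apply: le_min_riesz_energy => // x [xinj Ax]; rewrite mul1r addr0.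
apply: (@le_trans _ _ (energy_of s (x \o widen_ord nN))).
  apply: min_riesz_energy_le; rewrite ?card_ord//.
  by split=> [i j /xinj[/val_inj]|i] //; exact: Ax.
rewrite /energy_of [leRHS](bigID [pred i : 'I_N | (i < n)%N])/= -[leLHS]addr0.
have widenE (f : 'I_N -> R) (P : pred 'I_N) :
    \sum_(i < N | P i && (i < n)%N) f i =
    \sum_(i < n | P (widen_ord nN i)) f (widen_ord nN i).
  exact: big_ord_narrow_cond.
rewrite lerD ?sumr_ge0//; last first.
  by move=> i _; apply: sumr_ge0 => j _; exact: powR_ge0.
(* the pairs of the subfamily are among the pairs of the family *)
rewrite (widenE _ xpredT); apply: ler_sum => i _.
rewrite [leRHS](bigID [pred j : 'I_N | (j < n)%N])/= widenE -[leLHS]addr0.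
rewrite lerD ?sumr_ge0// => j _; exact: powR_ge0.
Qed.

End RieszEnergy.

(** * Energy on a self-similar set *)

Section SelfSimilarEnergy.
Context {R : realType} {p M : nat} {r : R} {psi : 'I_M -> 'cV[R]_p -> 'cV[R]_p}
  {A : set 'cV[R]_p}.
Hypothesis hA : self_similar_fractal (fun _ : 'I_M => r) psi A.
(* [b] stands for [s / d] *)
Context {s b : R}.
Hypotheses (s0 : 0 < s) (b1 : 1 < b) (hb : r `^ (- s) = M%:R `^ b).
Context {gap : R}.
Hypotheses (gap0 : 0 < gap) (hgap : forall m m' x y, m != m' -> A x -> A y ->
    gap <= euclid_norm (psi m x - psi m' y)).

Lemma riesz_kernel_far u : gap <= u -> u `^ (- s) <= gap `^ (- s).
Proof.
move=> gu; have u0 := lt_le_trans gap0 gu.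
rewrite !powRN lef_pV2 ?posrE ?powR_gt0//.
by rewrite ge0_ler_powR ?nnegrE ?(ltW s0) ?(ltW gap0) ?(ltW u0).
Qed.

Lemma riesz_kernel_piece m x y :
  euclid_norm (psi m x - psi m y) `^ (- s) =
  M%:R `^ b * euclid_norm (x - y) `^ (- s).
Proof.
by rewrite (piece_dist hA) powRM ?euclid_norm_ge0 ?(ltW (ratio_gt0 hA))// hb.
Qed.

Lemma sum_off_diagonal (T : finType) (f : 'I_M * T -> R) m t g : 0 <= g ->
  (forall m' u, m != m' -> f (m', u) <= g) ->
  \sum_(v | (m, t) != v) f v <=
  \sum_(u | t != u) f (m, u) + (M * #|T|)%:R * g.
Proof.
move=> g0 fg.
have -> : \sum_(v | (m, t) != v) f v =
    \sum_m' \sum_(u | (m, t) != (m', u)) f (m', u).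
  by rewrite pair_big_dep; apply: eq_big => -[].
rewrite (bigD1 m)//= lerD//.
  rewrite le_eqVlt; apply/orP; left; apply/eqP; apply: eq_bigl => u.
  by rewrite xpair_eqE eqxx.
apply: (@le_trans _ _ (\sum_(m' < M) \sum_(u : T) g)).
  rewrite [leLHS]big_mkcond; apply: ler_sum => m' _.
  case: ifPn => [mm'|_]; last by apply: sumr_ge0.
  rewrite [leLHS]big_mkcond; apply: ler_sum => u _.
  by case: ifPn => // _; apply: fg; rewrite eq_sym.
by rewrite !sumr_const card_ord -mulrnA mulr_natl mulnC.
Qed.

(** Copies of a configuration in the [M] pieces: each copy has its energy
    rescaled, and the interactions of different copies are bounded. *)
Lemma min_riesz_energy_copies N :
  (exists x : 'I_N -> 'cV[R]_p, config A x) ->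
  min_riesz_energy s A (M * N) <=
  (M%:R * M%:R `^ b) * min_riesz_energy s A N + gap `^ (- s) * (M * N)%:R ^+ 2.
Proof.
have M0 : 0 < M%:R :> R by rewrite ltr0n (ltnW (copies_ge2 hA)).
move=> exN; apply: le_min_riesz_energy => //; first by rewrite mulr_gt0 ?powR_gt0.
move=> x [xinj Ax]; pose z (v : 'I_M * 'I_N) := psi v.1 (x v.2).
apply: (@le_trans _ _ (energy_of s z)).
  apply: min_riesz_energy_le; first by rewrite card_prod !card_ord.
  split=> [[m i] [m' j] zE|[m i]]; last exact: (piece_sub hA).
  have [mm'|mm'] := eqVneq m m'.
    by move: zE; rewrite /z/= mm' => /(piece_inj hA)/xinj ->.
  have := hgap mm' (Ax i) (Ax j); rewrite -/(z (m, i)) -/(z (m', j)) zE subrr.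
  by rewrite euclid_norm0 leNgt gap0.
rewrite /energy_of.
apply: (@le_trans _ _ (\sum_(v : 'I_M * 'I_N)
    (\sum_(j | v.2 != j) M%:R `^ b * euclid_norm (x v.2 - x j) `^ (- s) +
     (M * N)%:R * gap `^ (- s)))).
  apply: ler_sum => -[m i] _; rewrite -[N in (M * N)%:R](card_ord N).
  have := @sum_off_diagonal _ (fun v => euclid_norm (z (m, i) - z v) `^ (- s))
    m i (gap `^ (- s)) (powR_ge0 _ _).
  move/(_ (fun m' u mm' => riesz_kernel_far (hgap mm' (Ax i) (Ax u)))).
  by under [X in _ <= X + _ -> _]eq_bigr do rewrite /z /= riesz_kernel_piece.
rewrite big_split /= lerD//; last first.
  rewrite sumr_const card_prod !card_ord -[leLHS]mulr_natr.
  by rewrite mulrAC -expr2 mulrC.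
rewrite -(pair_bigA _ (fun m i => \sum_(j | i != j) M%:R `^ b *
  euclid_norm (x i - x j) `^ (- s)))/=.
rewrite sumr_const card_ord -[leLHS]mulr_natl -[leRHS]mulrA ler_pM2l// mulr_sumr.
by under eq_bigr do rewrite -mulr_sumr.
Qed.

(** One cell [w0] is left out, as it may contain [x].  The recursion over the
    levels is [S (k + 1) <= M ^ b * S k + M * M ^ k * g],
    [g] being the bound of the interaction across a gap; it is solved by
    a multiple of [M ^ (b * k) - M ^ k]. *)
Lemma address_potential x0 : A x0 -> exists2 c : R, 0 <= c &
  forall k x, A x -> exists w0 : address M k,
    (forall w, w0 != w -> x <> cell_map psi w x0) /\
    \sum_(w | w0 != w) euclid_norm (x - cell_map psi w x0) `^ (- s) <=
      c * (M%:R `^ b) ^+ k.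
Proof.
move=> Ax0; have M2 := copies_ge2 hA.
have M0 : 0 < M%:R :> R by rewrite ltr0n ltnW.
have Mb : M%:R < M%:R `^ b :> R.
  by rewrite -[ltLHS]powRr1 ?(ltW M0)// gt1_ltr_powR// ltr1n.
pose g := gap `^ (- s).
have g0 : 0 <= g by exact: powR_ge0.
pose c := g * M%:R / (M%:R `^ b - M%:R).
have cE : g * M%:R = c * (M%:R `^ b - M%:R) by rewrite divfK// gt_eqF// subr_gt0.
have c0 : 0 <= c by apply: divr_ge0; [exact: mulr_ge0 | rewrite subr_ge0 ltW].
exists c => // k x Ax.
suff [w0 [neq le_c]] : exists w0 : address M k,
    (forall w, w0 != w -> x <> cell_map psi w x0) /\
    \sum_(w | w0 != w) euclid_norm (x - cell_map psi w x0) `^ (- s) <=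
      c * ((M%:R `^ b) ^+ k - M%:R ^+ k).
  exists w0; split=> //; apply: le_trans le_c _.
  by rewrite ler_wpM2l// gerBl exprn_ge0// ltW.
elim: k x Ax => [|k IH] x Ax.
  exists tt; split=> [[]//|].
  by rewrite big1 ?subrr ?mulr0// => -[].
have [m [x' [Ax' ->]]] := piece_cover hA Ax.
have [w0 [neq le_c]] := IH _ Ax'.
have far m' (w : address M k) : m != m' ->
    gap <= euclid_norm (psi m x' - psi m' (cell_map psi w x0)).
  by move=> mm'; apply: hgap => //; exact: (cell_map_sub hA).
exists (m, w0); split=> [[m' w] /= mw E|].
  have [mm'|mm'] := eqVneq m m'; last first.
    by have := far m' w mm'; rewrite E subrr euclid_norm0 leNgt gap0.
  move: mw E; rewrite mm' => mw /(piece_inj hA); apply: neq.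
  by apply: contra_neq mw => ->.
apply: le_trans (@sum_off_diagonal _ (fun v : 'I_M * address M k =>
    euclid_norm (psi m x' - psi v.1 (cell_map psi v.2 x0)) `^ (- s)) m w0 g g0 _) _.
  by move=> m' w mm' /=; apply: riesz_kernel_far; exact: far.
rewrite /= card_address.
under eq_bigr do rewrite riesz_kernel_piece.
rewrite -mulr_sumr -expnS natrX.
have -> : M%:R ^+ k.+1 * g = M%:R ^+ k * (c * (M%:R `^ b - M%:R)).
  by rewrite -cE exprS; ring.
apply: le_trans (lerD (ler_wpM2l (powR_ge0 _ _) le_c) (lexx _)) _.
rewrite !exprS; set a := _ ^+ k; set a' := _ ^+ k; lra.
Qed.

(** Each point of the configuration spoils at most one cell of level [k], so at
    least [N] cells remain.  The potentials at their representatives sum up to at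
    most [N * c * M ^ (b * k)], so one of them is at most [c * M ^ (b * k)]. *)
Lemma exists_low_potential x0 : A x0 -> exists2 c : R, 0 <= c &
  forall k N (x : 'I_N -> 'cV[R]_p), (forall i, A (x i)) -> (2 * N <= M ^ k)%N ->
  exists y, [/\ A y, forall i, x i <> y &
    \sum_i euclid_norm (x i - y) `^ (- s) <= c * (M%:R `^ b) ^+ k].
Proof.
move=> Ax0; have [c c0 hc] := address_potential Ax0.
exists c => // k N x Ax Nk.
have /choice[w0 hw0] i := hc k (x i) (Ax i).
pose G := (~: [set w0 i | i : 'I_N])%SET.
pose pot (w : address M k) := \sum_i euclid_norm (x i - cell_map psi w x0) `^ (- s).
have w0G w i : w \in G -> w0 i != w.
  by rewrite inE; apply: contraNneq => <-; apply/imsetP; exists i.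
have cardG : (N <= #|G| /\ 0 < #|G|)%N.
  have := leq_imset_card w0 predT; rewrite card_ord.
  have := cardsC [set w0 i | i : 'I_N]%SET; rewrite card_address -/G.
  have : (0 < M ^ k)%N by rewrite expn_gt0 (ltnW (copies_ge2 hA)).
  by move: Nk; move: (M ^ k)%N #|_| #|_| => a u v; lia.
have sumG : \sum_(w in G) pot w <= N%:R * (c * (M%:R `^ b) ^+ k).
  rewrite exchange_big /= -[N in N%:R](card_ord N) mulr_natl -sumr_const.
  apply: ler_sum => i _; have [_ +] := hw0 i; apply: le_trans.
  rewrite [leLHS]big_mkcond [leRHS]big_mkcond; apply: ler_sum => w _.
  by case: ifPn => [/w0G ->//|_]; case: ifPn => // _; exact: powR_ge0.
have [/existsP[w /andP[wG hw]]|] :=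
    boolP [exists w in G, pot w <= c * (M%:R `^ b) ^+ k].
  exists (cell_map psi w x0); split=> //; first exact: (cell_map_sub hA).
  by move=> i; have [+ _] := hw0 i; apply; exact: w0G.
rewrite negb_exists => /forallP none.
exfalso; move: sumG; apply/negP; rewrite -ltNge.
have [w wG] : exists w, w \in G by apply/set0Pn; rewrite -card_gt0; case: cardG.
apply: (@le_lt_trans _ _ (\sum_(w in G) c * (M%:R `^ b) ^+ k)).
  rewrite sumr_const -[leRHS]mulr_natl ler_wpM2r ?ler_nat//; last by case: cardG.
  by rewrite mulr_ge0// exprn_ge0// powR_ge0.
have potw v : v \in G -> c * (M%:R `^ b) ^+ k < pot v.
  by move=> vG; have := none v; rewrite vG/= -ltNge.
rewrite (bigD1 w)//= [ltRHS](bigD1 w)//= ltr_leD ?potw// ler_sum// => v /andP[vG _].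
exact/ltW/potw.
Qed.

Definition adjoin N (x : 'I_N -> 'cV[R]_p) y (i : unit + 'I_N) :=
  if i is inr j then x j else y.

Lemma config_adjoin N (x : 'I_N -> 'cV[R]_p) y :
  config A x -> A y -> (forall i, x i <> y) -> config A (adjoin x y).
Proof.
move=> [xinj Ax] Ay xy; split=> [[[]|i] [[]|j]|[[]|i]]//=.
- by move=> /esym/xy.
- by move=> /xy.
- by move=> /xinj ->.
Qed.

Lemma energy_adjoin N (x : 'I_N -> 'cV[R]_p) y : energy_of s (adjoin x y) =
  energy_of s x + 2 * \sum_i euclid_norm (x i - y) `^ (- s).
Proof.
rewrite /energy_of big_sumType /=.
under eq_bigr do rewrite big_sumType /=.
under [X in _ + X]eq_bigr do rewrite big_sumType /=.
rewrite (big_pred1 tt) => [|[]//].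
rewrite big_pred0 ?add0r => [|[]//].
rewrite big_split /=.
under [X in _ + (X + _)]eq_bigr do rewrite (big_pred1 tt) => [|[]//].
rewrite (eq_bigr (fun i => euclid_norm (x i - y) `^ (- s))); last first.
  by move=> i _; rewrite euclid_distC.
by rewrite mulr_natl mulr2n [RHS]addrC addrA; congr (_ + _ + _).
Qed.

Lemma exists_config N : exists x : 'I_N -> 'cV[R]_p, config A x.
Proof.
have [_ [[x0 Ax0] _] _ _ _] := hA.
have [c c0 hc] := exists_low_potential Ax0.
elim: N => [|N [x [xinj Ax]]].
  by exists (fun=> x0); split=> // -[].
have Nk : (2 * N <= M ^ N.+1)%N.
  rewrite (@leq_trans (2 ^ N.+1))//.
    by rewrite expnS leq_mul2l ltnW// ltn_expl.
  by rewrite leq_exp2r// (copies_ge2 hA).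
have [y [Ay xy _]] := hc N.+1 N x Ax Nk.
have [zinj Az] := config_adjoin (conj xinj Ax) Ay xy.
have cardE : #|{: unit + 'I_N}| = N.+1 by rewrite card_sum card_unit card_ord.
exists (fun i => adjoin x y (enum_val (cast_ord (esym cardE) i))).
split=> [i j /zinj/enum_val_inj/cast_ord_inj//|i]; exact: Az.
Qed.

(** The coarsest level with at least [2 * N] cells has at most [2 * M * N] of
    them, so that [M ^ (b * k)] is of order [N ^ b]. *)
Lemma min_riesz_energy_step : exists2 C : R, 0 <= C & forall N, (0 < N)%N ->
  min_riesz_energy s A N.+1 <= min_riesz_energy s A N + C * N%:R `^ b.
Proof.
have [_ [[x0 Ax0] _] _ _ _] := hA; have M2 := copies_ge2 hA.
have [c c0 hc] := exists_low_potential Ax0.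
exists (2 * c * (2 * M)%:R `^ b) => [|N N0].
  by rewrite !mulr_ge0 ?powR_ge0.
have exk : exists k, (2 * N <= M ^ k)%N.
  by exists (2 * N)%N; rewrite ltnW// ltn_expl.
have [k Nk Mk] : exists2 k, (2 * N <= M ^ k)%N & (M ^ k <= 2 * M * N)%N.
  case: (ex_minnP exk) => -[|k] Nk mink; first by move: Nk; rewrite expn0; lia.
  exists k.+1 => //; rewrite expnS mulnAC mulnC leq_mul2r; apply/orP; right.
  by rewrite ltnW// ltnNge; apply/negP => /mink; rewrite ltnn.
rewrite -[X in _ <= X + _]mul1r.
apply: le_min_riesz_energy => //; first exact: exists_config.
move=> x [xinj Ax]; have [y [Ay xy hy]] := hc k N x Ax Nk.
apply: (@le_trans _ _ (energy_of s (adjoin x y))).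
  apply: min_riesz_energy_le; first by rewrite card_sum card_unit card_ord.
  exact: config_adjoin.
rewrite energy_adjoin mul1r lerD2l -!mulrA ler_pM2l//; apply: le_trans hy _.
rewrite ler_wpM2l// -powRM// -natrM -powR_mulrn ?powR_ge0// -powRrM [b * _]mulrC powRrM.
rewrite powR_mulrn// -natrX ge0_ler_powR ?nnegrE ?ler_nat//.
by rewrite ltW// (lt_trans ltr01).
Qed.

End SelfSimilarEnergy.

(** * Fractional parts of logarithms *)

Definition frac_log (R : realType) (M N : nat) : R :=
  frac_part (ln (N%:R : R) / ln (M%:R : R)).

Section FracLog.
Context {R : realType} {M : nat}.
Hypothesis M2 : (2 <= M)%N.

Let M0 : 0 < M%:R :> R. Proof. by rewrite ltr0n ltnW. Qed.
Let lM : 0 < ln (M%:R : R). Proof. by rewrite ln_gt0// ltr1n. Qed.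

(** The logarithms differ by the difference [k] of their integer parts, up to
    the difference of their fractional parts. *)
Lemma frac_log_close (N n : nat) (tau : R) : (0 < N <= n)%N -> 0 < tau ->
  `|frac_log R M n - frac_log R M N| < ln (1 + tau) / ln M%:R ->
  exists k, n%:R <= (M ^ k)%:R * N%:R * (1 + tau) :> R /\
    (M ^ k)%:R * N%:R <= n%:R * (1 + tau) :> R.
Proof.
move=> /andP[N0 Nn] tau0.
have N0' : 0 < N%:R :> R by rewrite ltr0n.
have n0' : 0 < n%:R :> R by rewrite ltr0n (leq_trans N0).
have t0' : 0 < 1 + tau by rewrite addr_gt0.
rewrite /frac_log /frac_part.
set u := ln n%:R / _; set v := ln N%:R / _.
have fle : Num.floor v <= Num.floor u.
  by apply: le_floor; rewrite ler_pM2r ?invr_gt0// ler_ln ?posrE// ler_nat.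
have [k kE] : exists k : nat, (Num.floor u)%:~R = (Num.floor v)%:~R + k%:R :> R.
  exists `|Num.floor u - Num.floor v|%N.
  by rewrite -[X in _ + X]/((Posz _)%:~R) gez0_abs ?subr_ge0// rmorphB/= addrC subrK.
rewrite kE ltr_norml => /andP[lo hi]; exists k.
have powE m : (0 < m)%N -> m%:R = expR (ln m%:R) :> R.
  by move=> m0; rewrite lnK// posrE ltr0n.
have MkE : (M ^ k)%:R = expR (ln M%:R * k%:R) :> R.
  by rewrite expRM_natr lnK ?posrE// natrX.
have -> : 1 + tau = expR (ln (1 + tau)) by rewrite lnK.
rewrite MkE (powE n (leq_trans N0 Nn)) (powE N N0) -!expRD !ler_expR.
have uE : ln n%:R = u * ln M%:R by rewrite divfK// gt_eqF.
have vE : ln N%:R = v * ln M%:R by rewrite divfK// gt_eqF.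
have tE : ln (1 + tau) = ln (1 + tau) / ln M%:R * ln M%:R by rewrite divfK// gt_eqF.
rewrite uE vE tE; move: lo hi; set w := ln (1 + tau) / _; set l := ln M%:R.
clearbody u v w; move=> lo hi; rewrite [l * _]mulrC -!mulrDl !ler_pM2r//.
by split; move: lo hi; lra.
Qed.

(** The first integer above [M ^ (j + a')] has a logarithm only slightly above
    [j + a'] if [j] is large. *)
Lemma frac_log_dense (a delta : R) (N0 : nat) : 0 <= a <= 1 -> 0 < delta ->
  exists2 N, (N0 <= N)%N & `|frac_log R M N - a| < delta.
Proof.
move=> /andP[a0 a1] d0.
(* the fractional part 1 is not attained, but it can be approached from below *)
have [a' [a'0 a'1 aa']] : exists a', [/\ 0 <= a', a' < 1 & `|a' - a| < delta / 2].
  have [ale|age] := ltP a 1.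
    by exists a; split=> //; rewrite subrr normr0 divr_gt0.
  have -> : a = 1 by apply/le_anti/andP.
  have [dle|dge] := leP delta 1.
    by exists (1 - delta / 4); rewrite ltr_norml; split; lra.
  by exists (1 - 1 / 4); rewrite ltr_norml; split; lra.
have [sg [sg0 sg1 sgd]] : exists sg, [/\ 0 < sg, a' + sg < 1 & sg < delta / 2].
  have [h|h] := leP ((1 - a') / 2) (delta / 4).
    by exists ((1 - a') / 2); split; lra.
  by exists (delta / 4); split; lra.
have Ms : 1 < M%:R `^ sg :> R.
  by rewrite -[ltLHS](powRr0 (M%:R : R)) gt1_ltr_powR// ltr1n.
pose j := maxn N0 (Num.truncn (M%:R `^ sg - 1)^-1).+1.
have Mj m : (m <= M ^ m)%N by rewrite ltnW// ltn_expl.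
have jbig : 1 <= (M ^ j)%:R * (M%:R `^ sg - 1) :> R.
  rewrite -ler_pdivrMr ?subr_gt0// mul1r.
  apply: (@le_trans _ _ j%:R); last by rewrite ler_nat Mj.
  apply: le_trans (ltW (truncnS_gt _)) _.
  by rewrite ler_nat leq_maxr.
pose x : R := (M ^ j)%:R * M%:R `^ a'.
have Mj0 : 0 < (M ^ j)%:R :> R by rewrite ltr0n expn_gt0 ltnW.
have Ma1 : 1 <= M%:R `^ a' :> R.
  by rewrite -[leLHS](powRr0 (M%:R : R)) ler_powR// ler1n ltnW.
have x0 : 0 < x by rewrite mulr_gt0// powR_gt0.
pose N := (Num.truncn x).+1.
have xN : x < N%:R by exact: truncnS_gt.
have Nx : N%:R <= x * M%:R `^ sg.
  have : N%:R <= x + 1 by rewrite /N -natr1 lerD2r truncn_le// ltW.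
  move=> /le_trans; apply; rewrite -lerBrDl -[X in _ - X]mulr1 -mulrBr.
  apply: le_trans jbig _; rewrite ler_wpM2r ?subr_ge0 ?(ltW Ms)//.
  by rewrite /x ler_peMr// ltW.
exists N.
  have : (N0 <= M ^ j)%N.
    by apply: leq_trans (Mj j); rewrite leq_maxl.
  move=> /leq_trans; apply; rewrite -(ler_nat R) (le_trans _ (ltW xN))//.
  by rewrite /x ler_peMr// ltW.
have lx : ln x = (j%:R + a') * ln M%:R.
  by rewrite lnM ?posrE ?powR_gt0// natrX lnXn// ln_powR mulrDl mulr_natl.
have N0' : 0 < N%:R :> R by rewrite ltr0n.
have lo : j%:R + a' <= ln N%:R / ln M%:R.
  by rewrite ler_pdivlMr// -lx ler_ln ?posrE// ltW.
have hi : ln N%:R / ln M%:R <= j%:R + a' + sg.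
  rewrite ler_pdivrMr// mulrDl -lx -ln_powR -lnM ?posrE ?powR_gt0//.
  by rewrite ler_ln ?posrE// mulr_gt0 ?powR_gt0.
clearbody N x j.
have floorE : Num.floor (ln (N%:R : R) / ln (M%:R : R)) = j.
  apply: floor_def; rewrite intrD -[(Posz j)%:~R]/(j%:R : R).
  by apply/andP; split; move: lo hi; lra.
rewrite /frac_log /frac_part floorE -[(Posz j)%:~R]/(j%:R : R).
move: aa'; rewrite !ltr_norml => /andP[? ?]; apply/andP; split; lra.
Qed.

End FracLog.

(** * Limits of almost decreasing sequences *)

Section AlmostDecreasing.
Context {R : realType} {fr e : nat -> R} {C : R}.
Hypotheses (e0 : forall N, 0 <= e N) (eC : forall N, (0 < N)%N -> e N <= C).
Hypothesis e_decr : forall eta, 0 < eta -> exists2 delta, 0 < delta &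
  exists N0, forall N n, (N0 <= N <= n)%N -> `|fr n - fr N| < delta ->
    e n <= e N + eta.

(** Convergence of [e] to [l] along the filter of the indices [N] tending to
    infinity with [fr N] tending to [a]; this filter may be improper. *)
Definition near_limit (a l : R) := forall eta, 0 < eta ->
  exists2 delta, 0 < delta & exists N0, forall N, (N0 <= N)%N ->
    `|fr N - a| < delta -> `|e N - l| <= eta.

(** The limit is the lower limit: a late index where [e] is close to its lower
    limit bounds [e] from above at all later indices close to [a]. *)
Lemma almost_decreasing_cvg a : exists l, near_limit a l.
Proof.
(* if no late index is close to [a], any number is a limit *)
have [prop|] := pselect (forall delta N0, 0 < delta ->
    exists2 N, (N0 <= N)%N & `|fr N - a| < delta); last first.
  move=> /existsNP[delta] /existsNP[N0] /not_implyP[d0 none].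
  exists 0 => eta eta0; exists delta => //; exists N0 => N NN0 aN.
  by exfalso; apply: none; exists N.
pose S := [set v | exists2 delta, 0 < delta & exists N0, forall N,
  (N0 <= N)%N -> `|fr N - a| < delta -> v <= e N].
have S0 : S 0 by exists 1 => //; exists 0%N.
have SC : ubound S C.
  move=> v [delta d0 [N0 hv]]; have [N NN0 aN] := prop delta N0.+1 d0.
  by apply: le_trans (hv N (ltnW NN0) aN) (eC (leq_ltn_trans (leq0n _) NN0)).
have supS : has_sup S by split; [exists 0 | exists C].
exists (sup S) => eta eta0.
have eta2 : 0 < eta / 2 by rewrite divr_gt0.
have [delta d0 [N0 decr]] := e_decr eta2.
have d2 : 0 < delta / 2 by rewrite divr_gt0.
have close N n : `|fr N - a| < delta / 2 -> `|fr n - a| < delta / 2 ->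
    `|fr n - fr N| < delta.
  by rewrite !ltr_norml => /andP[? ?] /andP[? ?]; apply/andP; split; lra.
have [N1 [NN1 aN1 eN1]] : exists N1, [/\ (N0 <= N1)%N, `|fr N1 - a| < delta / 2 &
    e N1 < sup S + eta / 2].
  apply: contrapT => none; have : S (sup S + eta / 2).
    exists (delta / 2) => //; exists N0 => N NN0 aN.
    by rewrite leNgt; apply/negP => lt; apply: none; exists N.
  move=> /(ub_le_sup (ex_intro _ C SC)); lra.
exists (delta / 2) => //; exists N1 => N NN1' aN.
have upper : e N <= e N1 + eta / 2.
  by apply: decr; [rewrite NN1 | exact: close].
have lower : sup S <= e N + eta / 2.
  apply: ge_sup; first by exists 0.
  move=> v [delta' d'0 [N2 hv]].
  have [|n Nn an] := prop (Num.min (delta / 2) delta') (maxn N N2).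
    by rewrite lt_min d2.
  move: an Nn; rewrite lt_min geq_max => /andP[an1 an2] /andP[Nn N2n].
  apply: le_trans (hv n N2n an2) _; apply: decr; last exact: close.
  by rewrite Nn (leq_trans NN1 NN1').
by rewrite ler_norml; apply/andP; split; lra.
Qed.

Lemma near_limit_cvg (NN : set nat) a l : near_limit a l ->
  fr @ within NN \oo --> a -> e @ within NN \oo --> l.
Proof.
move=> lim_l /cvgrPdist_lt fr_a; apply/cvgrPdist_le => eta eta0.
have [delta d0 [N0 h]] := lim_l _ eta0.
have late : \forall N \near \oo, (N0 <= N)%N by exists N0.
have := fr_a delta d0; rewrite !near_withinE => fr_a'.
apply: filterS2 fr_a' late => N hN NN0 NNN; rewrite distrC; apply: h => //.
by rewrite distrC; exact: hN.
Qed.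

(** An index [N] that is close to [b] is also close to [a], so that [e N]
    approximates both [g b] and [g a]. *)
Lemma near_limit_continuous (g : R -> R) (D : set R) :
  (forall a delta N0, D a -> 0 < delta ->
    exists2 N, (N0 <= N)%N & `|fr N - a| < delta) ->
  (forall a, near_limit a (g a)) -> {within D, continuous g}.
Proof.
move=> dense hg; apply/subspace_continuousP => a Da.
apply/cvgrPdist_le => eta eta0; have eta2 : 0 < eta / 2 by rewrite divr_gt0.
have [delta d0 [N0 ha]] := hg a _ eta2.
have d2 : 0 < delta / 2 by rewrite divr_gt0.
rewrite near_withinE; exists (delta / 2) => //= b ab Db.
have [delta' d'0 [N1 hb]] := hg b _ eta2.
have [|N NN] := dense b (Num.min (delta / 2) delta') (maxn N0 N1) Db.
  by rewrite lt_min d2.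
move: NN; rewrite geq_max lt_min => /andP[NN0 NN1] /andP[bN bN'].
have {}ha : `|e N - g a| <= eta / 2.
  apply: ha => //; move: ab bN; rewrite /ball_/= !ltr_norml => /andP[? ?] /andP[? ?].
  by apply/andP; split; lra.
suff : `|g a - g b| <= eta by [].
move: ha (hb N NN1 bN'); rewrite !ler_norml => /andP[? ?] /andP[? ?].
by apply/andP; split; lra.
Qed.

End AlmostDecreasing.

(** * Sequences that scale at most like a power under multiplication by M *)

Lemma expr1D_le (R : realDomainType) (tau : R) (Q : nat) : 0 <= tau <= 1 ->
  (1 + tau) ^+ Q <= 1 + tau * (2 ^+ Q - 1).
Proof.
move=> /andP[tau0 tau1]; elim: Q => [|Q IH]; first by rewrite !expr0 subrr mulr0 addr0.
rewrite exprS mulrC; apply: le_trans (ler_wpM2r _ IH) _; first by rewrite addr_ge0.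
have a1 : 1 <= 2 ^+ Q :> R by rewrite exprn_ege1// ler1n.
rewrite exprS; move: (2 ^+ Q) a1 => a a1.
have : 0 <= tau * (1 - tau) * (a - 1) by rewrite !mulr_ge0// subr_ge0.
by lra.
Qed.

Section Subscaling.
Context {R : realType} {M : nat} {b K C : R} {E : nat -> R}.
Hypotheses (M2 : (2 <= M)%N) (b1 : 1 < b) (K0 : 0 <= K) (C0 : 0 <= C).
Hypotheses (E0 : forall N, 0 <= E N)
  (E_mono : forall n N, (n <= N)%N -> E n <= E N)
  (E_copies : forall N,
    E (M * N)%N <= M%:R * M%:R `^ b * E N + K * (M * N)%:R ^+ 2)
  (E_step : forall N, (0 < N)%N -> E N.+1 <= E N + C * N%:R `^ b).

Let M0 : 0 < M%:R :> R. Proof. by rewrite ltr0n ltnW. Qed.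
Let b0 : 0 <= b. Proof. exact: le_trans ler01 (ltW b1). Qed.

Let c := K * M%:R / (M%:R `^ b - M%:R).

(* adding [c * N ^ 2] absorbs the quadratic error of [E_copies] *)
Let F N := E N + c * N%:R ^+ 2.

Let Mb : 0 < M%:R `^ b - M%:R :> R.
Proof.
by rewrite subr_gt0 -[ltLHS]powRr1 ?(ltW M0)// gt1_ltr_powR// ltr1n.
Qed.

Let c0 : 0 <= c.
Proof. by apply: divr_ge0; [apply: mulr_ge0 => // | exact: ltW]. Qed.

Let F0 N : 0 <= F N.
Proof. by rewrite addr_ge0// mulr_ge0// sqr_ge0. Qed.

Let F_mono n N : (n <= N)%N -> F n <= F N.
Proof.
move=> nN; rewrite lerD ?E_mono// ler_wpM2l// lerXn2r ?nnegrE// ler_nat//.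
Qed.

Let powRS x : 0 <= x -> x `^ (1 + b) = x * x `^ b :> R.
Proof.
move=> x0; rewrite powRD; first by rewrite powRr1.
by rewrite gt_eqF// addr_gt0// (lt_trans ltr01).
Qed.

Let F_copies N : F (M * N) <= M%:R `^ (1 + b) * F N.
Proof.
rewrite powRS ?(ltW M0)// /F.
apply: le_trans (lerD (E_copies N) (lexx _)) _.
have cE : K * M%:R = c * (M%:R `^ b - M%:R) by rewrite divfK// gt_eqF.
have -> : K * (M * N)%:R ^+ 2 = M%:R * (c * (M%:R `^ b - M%:R)) * N%:R ^+ 2.
  by rewrite -cE natrM; ring.
by rewrite le_eqVlt; apply/orP; left; apply/eqP; rewrite natrM; ring.
Qed.

Let F_copies_iter k N : F (M ^ k * N) <= (M ^ k)%:R `^ (1 + b) * F N.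
Proof.
elim: k => [|k IH]; first by rewrite expn0 mul1n powR1 mul1r.
rewrite expnS -mulnA natrM powRM// -mulrA; apply: le_trans (F_copies _) _.
by rewrite ler_wpM2l// powR_ge0.
Qed.

Let C' := C + 3 * c.

Let C'0 : 0 <= C'. Proof. by rewrite addr_ge0// mulr_ge0. Qed.

Let F_step N : (0 < N)%N -> F N.+1 <= F N + C' * N%:R `^ b.
Proof.
move=> N0; have N1 : 1 <= N%:R :> R by rewrite ler1n.
have Nb : N%:R <= N%:R `^ b :> R by rewrite le1r_powR// ltW.
rewrite /F /C' -natr1; have := E_step N0.
have : c * N%:R <= c * N%:R `^ b by rewrite ler_wpM2l.
have : c * 1 <= c * N%:R by rewrite ler_wpM2l.
move: (N%:R `^ b) (N%:R : R) => u v; lra.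
Qed.

Let F_steps N N' : (0 < N <= N')%N ->
  F N' <= F N + (N'%:R - N%:R) * (C' * N'%:R `^ b).
Proof.
case/andP=> N0; elim: N' => [|N' IH].
  by rewrite leqn0 => /eqP N00; rewrite N00 in N0.
rewrite leq_eqVlt ltnS => /orP[/eqP ->|NN']; first by rewrite subrr mul0r addr0.
apply: le_trans (F_step (leq_trans N0 NN')) _.
have NN'R : N%:R <= N'%:R :> R by rewrite ler_nat.
have pow : C' * N'%:R `^ b <= C' * N'.+1%:R `^ b.
  by rewrite ler_wpM2l// ge0_ler_powR ?nnegrE// ler_nat.
apply: le_trans (lerD (IH NN') pow) _.
have := ler_wpM2l _ pow; move/(_ (N'%:R - N%:R)); rewrite subr_ge0 => /(_ NN'R).
rewrite -natr1; lra.
Qed.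

Let C1 := F 1 + C'.

Let F_le N : (0 < N)%N -> F N <= C1 * N%:R `^ (1 + b).
Proof.
move=> N0; have N1 : 1 <= N%:R :> R by rewrite ler1n.
have Nb : 1 <= N%:R `^ b :> R by rewrite (le_trans N1)// le1r_powR// ltW.
apply: le_trans (@F_steps 1 N _) _ => //.
rewrite powRS// /C1 [leRHS]mulrDl lerD//.
  by rewrite ler_peMr// -[leLHS]mulr1 ler_pM.
by rewrite mulrCA ler_wpM2l// ler_wpM2r ?(le_trans ler01)// gerBl.
Qed.

Lemma subscaling_bounded : exists B : R,
  forall N, (0 < N)%N -> E N / N%:R `^ (1 + b) <= B.
Proof.
exists C1 => N N0; rewrite ler_pdivrMr ?powR_gt0 ?ltr0n//.
by apply: le_trans (F_le N0); rewrite lerDl mulr_ge0// sqr_ge0.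
Qed.

(** If [n] is nearly [M ^ k * N], it is at most [M ^ k * N'] for some [N']
    slightly above [N]; [F] grows by a controlled amount from [N] to [N'] and
    does not exceed the exact scaling from [N'] to [M ^ k * N']. *)
Let F_compare N n k tau : (0 < N)%N -> 0 < tau <= 1 -> 2 / tau <= N%:R ->
  n%:R <= (M ^ k)%:R * N%:R * (1 + tau / 2) ->
  (M ^ k)%:R * N%:R <= n%:R * (1 + tau / 2) :> R ->
  F n <= (n%:R * (1 + tau)) `^ (1 + b) *
    (F N / N%:R `^ (1 + b) + tau * (C' * (1 + tau) `^ b)).
Proof.
move=> N0 /andP[tau0 tau1] Nbig nle nge.
have NR : 0 < N%:R :> R by rewrite ltr0n.
pose N' := (Num.truncn (N%:R * (1 + tau / 2))).+1.
have x0 : 0 <= N%:R * (1 + tau / 2) by rewrite mulr_ge0// addr_ge0// divr_ge0// ltW.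
have xN' : N%:R * (1 + tau / 2) <= N'%:R by apply/ltW/truncnS_gt.
have N'x : N'%:R <= N%:R * (1 + tau).
  have : N'%:R <= N%:R * (1 + tau / 2) + 1 by rewrite /N' -natr1 lerD2r truncn_le.
  move: Nbig; rewrite ler_pdivrMr//; clearbody N'; lra.
have NN' : (N <= N')%N.
  rewrite -(ler_nat R); apply: le_trans xN'.
  by rewrite ler_peMr// lerDl divr_ge0// ltW.
clearbody N'.
have nN' : (n <= M ^ k * N')%N.
  by rewrite -(ler_nat R) natrM; apply: le_trans nle _; rewrite -mulrA ler_wpM2l.
apply: le_trans (F_mono nN') _; apply: le_trans (F_copies_iter k N') _.
have FN' : F N' <= N%:R `^ (1 + b) *
    (F N / N%:R `^ (1 + b) + tau * (C' * (1 + tau) `^ b)).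
  rewrite mulrDr mulrCA divff ?mulr1; last by rewrite gt_eqF// powR_gt0.
  apply: le_trans (F_steps (introT andP (conj N0 NN'))) _.
  rewrite lerD2l powRS//.
  have -> : N%:R * N%:R `^ b * (tau * (C' * (1 + tau) `^ b)) =
      (N%:R * tau) * (C' * (N%:R * (1 + tau)) `^ b).
    by rewrite powRM// ?addr_ge0 ?(ltW tau0)//; ring.
  apply: ler_pM; rewrite ?subr_ge0 ?ler_nat ?mulr_ge0 ?powR_ge0//.
    by rewrite lerBlDl; move: N'x; rewrite mulrDr mulr1.
  by rewrite ler_wpM2l// ge0_ler_powR ?nnegrE ?mulr_ge0// addr_ge0// ltW.
apply: le_trans (ler_wpM2l (powR_ge0 _ _) FN') _.
rewrite mulrA ler_wpM2r//.
  by rewrite addr_ge0 ?divr_ge0 ?mulr_ge0 ?powR_ge0// ltW.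
rewrite -powRM// ge0_ler_powR ?nnegrE ?mulr_ge0 ?addr_ge0 ?(ltW tau0)//.
apply: le_trans nge _; rewrite ler_wpM2l// lerD2l; lra.
Qed.

(** In [F_compare], both the excess of [(1 + tau) ^ (1 + b)] over [1] and the
    term added to [F N / N ^ (1 + b)] are of order [tau]; their total effect is
    at most [tau * B]. *)
Lemma subscaling_almost_decreasing eta : 0 < eta -> exists2 delta, 0 < delta &
  exists N0, forall N n, (N0 <= N <= n)%N ->
    `|frac_log R M n - frac_log R M N| < delta ->
    E n / n%:R `^ (1 + b) <= E N / N%:R `^ (1 + b) + eta.
Proof.
move=> eta0.
have [Q bQ] : exists Q : nat, 1 + b <= Q%:R.
  by exists (Num.truncn (1 + b)).+1; apply/ltW/truncnS_gt.
pose B := 2 ^+ Q * C1 + 2 ^+ Q * (C' * 2 `^ b).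
have C10 : 0 <= C1 by rewrite addr_ge0.
have B0 : 0 <= B by rewrite addr_ge0 ?mulr_ge0 ?powR_ge0 ?exprn_ge0.
have [tau [tau0 tau1 tauB]] : exists tau, [/\ 0 < tau, tau <= 1 & tau * B <= eta / 2].
  exists (Num.min 1 (eta / 2 / (B + 1))).
  have B1 : 0 < B + 1 by rewrite ltr_wpDl.
  have e2 : 0 < eta / 2 by rewrite divr_gt0.
  split; [by rewrite lt_min ltr01 divr_gt0 | by rewrite ge_min lexx |].
  apply: (@le_trans _ _ (eta / 2 / (B + 1) * B)).
    by rewrite ler_wpM2r// ge_min lexx orbT.
  by rewrite mulrAC ler_pdivrMr// ler_wpM2l ?(ltW e2)// lerDl.
have tau2 : 0 < tau / 2 by rewrite divr_gt0.
have lM : 0 < ln (M%:R : R) by rewrite ln_gt0// ltr1n.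
exists (ln (1 + tau / 2) / ln M%:R); first by rewrite divr_gt0// ln_gt0// ltrDl.
pose N1 := (Num.truncn (2 / tau)).+1.
(* from [x] on, the correction [c * N ^ 2] is below [eta / 2 * N ^ (1 + b)] *)
pose x := (2 * c / eta) `^ (b - 1)^-1.
pose N2 := (Num.truncn x).+1.
exists (maxn N1 N2) => N n /andP[]; rewrite geq_max => /andP[NN1 NN2] Nn.
have N0 : (0 < N)%N by exact: leq_trans NN1.
move=> /(frac_log_close M2 (introT andP (conj N0 Nn)) tau2)[k [nle nge]].
have NR : 0 < N%:R :> R by rewrite ltr0n.
have nR : 0 < n%:R :> R by rewrite ltr0n (leq_trans N0).
have Nbig : 2 / tau <= N%:R.
  by apply: le_trans (ltW (truncnS_gt _)) _; rewrite ler_nat.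
have Nbig2 : 2 * c / eta <= N%:R `^ (b - 1).
  have -> : 2 * c / eta = x `^ (b - 1).
    rewrite /x -powRrM mulVf; last by rewrite gt_eqF// subr_gt0.
    rewrite powRr1//; apply: divr_ge0; last exact: ltW.
    exact: mulr_ge0.
  rewrite ge0_ler_powR ?nnegrE ?powR_ge0 ?subr_ge0 ?(ltW b1)//.
  by apply: le_trans (ltW (truncnS_gt _)) _; rewrite ler_nat.
clear NN1 NN2; clearbody x.
have := F_compare N0 (introT andP (conj tau0 tau1)) Nbig nle nge.
set f := F N / _; set g := C' * _.
have f0 : 0 <= f by rewrite divr_ge0// powR_ge0.
have fC1 : f <= C1 by rewrite ler_pdivrMr ?powR_gt0// F_le.
have g0 : 0 <= g by rewrite mulr_ge0// powR_ge0.
have g2 : g <= C' * 2 `^ b.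
  by rewrite ler_wpM2l// ge0_ler_powR ?nnegrE ?addr_ge0 ?(ltW tau0)//; lra.
have fE : f <= E N / N%:R `^ (1 + b) + eta / 2.
  rewrite /f /F mulrDl lerD2l ler_pdivrMr ?powR_gt0//.
  have -> : N%:R `^ (1 + b) = N%:R ^+ 2 * N%:R `^ (b - 1).
    rewrite -powR_mulrn// -powRD; last by rewrite (gt_eqF NR) implybT.
    by congr (_ `^ _); ring.
  rewrite [leRHS]mulrCA [leLHS]mulrC ler_wpM2l ?sqr_ge0//.
  by move: Nbig2; rewrite ler_pdivrMr//; lra.
have pow : (1 + tau) `^ (1 + b) <= 1 + tau * (2 ^+ Q - 1).
  apply: le_trans (expr1D_le Q (introT andP (conj (ltW tau0) tau1))).
  by rewrite -powR_mulrn ?addr_ge0 ?(ltW tau0)// ler_powR// lerDl ltW.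
have pow2 : (1 + tau) `^ (1 + b) <= 2 ^+ Q.
  apply: le_trans pow _; rewrite -lerBrDl ler_piMl//.
  by rewrite subr_ge0 exprn_ege1// ler1n.
rewrite powRM ?addr_ge0 ?(ltW tau0)// -mulrA mulrC -ler_pdivrMr ?powR_gt0// => Fn.
apply: (@le_trans _ _ (F n / n%:R `^ (1 + b))).
  by rewrite ler_pM2r ?invr_gt0 ?powR_gt0// lerDl mulr_ge0// sqr_ge0.
apply: le_trans Fn _.
have -> : eta = eta / 2 + eta / 2 by lra.
rewrite addrA; apply: (@le_trans _ _ (f + tau * B)); last by rewrite lerD.
have h1 : (1 + tau) `^ (1 + b) * f <= f + tau * (2 ^+ Q * C1).
  apply: le_trans (ler_wpM2r f0 pow) _; rewrite mulrDl mul1r lerD2l.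
  rewrite -mulrA ler_pM2l//; apply: ler_pM => //; last by rewrite gerBl.
  by rewrite subr_ge0 exprn_ege1// ler1n.
have h2 : (1 + tau) `^ (1 + b) * (tau * g) <= tau * (2 ^+ Q * (C' * 2 `^ b)).
  by rewrite mulrCA ler_pM2l//; apply: ler_pM => //; exact: powR_ge0.
rewrite mulrDr; apply: le_trans (lerD h1 h2) _.
by rewrite -addrA -mulrDr.
Qed.

End Subscaling.

(** * Existence and continuity of the limits *)

Lemma exists_frac_log_limit (R : realType) (M : nat) (a : R) : (2 <= M)%N ->
  0 <= a <= 1 -> exists NN : set nat, infinite_set NN /\ frac_log_limit M NN a.
Proof.
move=> M2 a01.
have /choice[u hu] : forall k : nat, exists N : nat,
    (k <= N)%N /\ `|frac_log R M N - a| < k.+1%:R^-1.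
  move=> k; have [|N kN aN] := @frac_log_dense R M M2 a k.+1%:R^-1 k a01.
    by rewrite invr_gt0 ltr0n.
  by exists N.
exists (range u); split.
  move=> /finite_seqP[t tE].
  have [ku _] := hu (\max_(i <- t) i).+1.
  have : range u (u (\max_(i <- t) i).+1) by exists (\max_(i <- t) i).+1.
  rewrite tE /= => ut; move: ku; rewrite ltnNge.
  by rewrite (@leq_bigmax_seq _ t xpredT id _ ut isT).
apply/cvgrPdist_lt => eta eta0.
pose k := Num.truncn eta^-1.
rewrite near_withinE; exists (\max_(i < k.+1) u i).+1 => // N /= kN [i _ iN].
have [_ aui] := hu i.
rewrite distrC -iN; apply: lt_le_trans aui _.
rewrite -[leRHS]invrK lef_pV2 ?posrE ?invr_gt0// ?ltr0n//.
apply: le_trans (ltW (truncnS_gt _)) _; rewrite ler_nat ltnS -/k.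
(* [N] exceeds all [u i] with [i <= k] *)
rewrite leqNgt; apply/negP => ik; move: kN; rewrite -iN ltnNge.
by rewrite (leq_bigmax (Ordinal (leq_trans ik (leqnSn k)))).
Qed.

Theorem theorem4p3 (R : realType) (p M : nat) (A : set 'cV[R]_p)
    (r : R) (psi : 'I_M -> 'cV[R]_p -> 'cV[R]_p) (d s : R)
    (hA : self_similar_fractal (fun _ : 'I_M => r) psi A)
    (hd : hausdorff_dim A = d%:E)
    (hs : d < s) :
  (forall (NN1 NN2 : set nat) (a1 a2 : R),
      infinite_set NN1 -> infinite_set NN2 ->
      frac_log_limit M NN1 a1 -> frac_log_limit M NN2 a2 ->
      a1 = a2 ->
      exists e1 e2 : R,
        [/\ energy_limit s d A NN1 e1, energy_limit s d A NN2 e2 & e1 = e2])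
  /\
  (exists g : R -> R,
      limit_energy_function M s d A g /\ {within `[0, 1], continuous g}).
Proof.
have M2 := copies_ge2 hA; have r0 := ratio_gt0 hA; have r1 := ratio_lt1 hA.
have lr : 0 < - ln r by rewrite oppr_gt0 ln_lt0// r0.
have lM : 0 < ln (M%:R : R) by rewrite ln_gt0// ltr1n.
have dE : d = ln M%:R / - ln r.
  by have := hausdorff_dim_self_similar hA; rewrite hd => -[].
have d0 : 0 < d by rewrite dE divr_gt0.
have s0 : 0 < s by exact: lt_trans hs.
have b1 : 1 < s / d by rewrite ltr_pdivlMr// mul1r.
have hb : r `^ (- s) = M%:R `^ (s / d).
  rewrite /powR !gt_eqF ?ltr0n ?(ltnW M2)//; congr expR.
  rewrite dE invf_div mulrA divfK; last by rewrite gt_eqF.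
  by rewrite mulrN mulNr.
have [gap gap0 hgap] := piece_gap hA.
have exN := exists_config hA s0 b1 hb gap0 hgap.
have [C C0 E_step] := min_riesz_energy_step hA s0 b1 hb gap0 hgap.
have E_copies N := min_riesz_energy_copies hA s0 hb gap0 hgap (exN N).
have E_mono n N (nN : (n <= N)%N) := @min_riesz_energy_mono _ _ s A n N nN (exN N).
have E0 N := min_riesz_energy_ge0 s A N.
have K0 : 0 <= gap `^ (- s) by exact: powR_ge0.
pose e N := min_riesz_energy s A N / N%:R `^ (1 + s / d).
have e0 N : 0 <= e N by rewrite divr_ge0// powR_ge0.
have [B eB] := subscaling_bounded M2 b1 K0 C0 E0 E_step.
have e_decr := subscaling_almost_decreasing M2 b1 K0 C0 E0 E_mono E_copies E_step.
have /choice[g hg] := almost_decreasing_cvg e0 eB e_decr.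
have conv NN a : frac_log_limit M NN a -> energy_limit s d A NN (g a).
  exact: near_limit_cvg (hg a).
split=> [NN1 NN2 a1 a2 _ _ lim1 lim2 a12|].
  by exists (g a1), (g a2); split; [exact: conv | exact: conv | rewrite a12].
exists g; split=> [a a01|].
  by split=> [|NN _]; [exact: exists_frac_log_limit | exact: conv].
apply: near_limit_continuous hg => a delta N0 /= a01 delta0.
by apply: frac_log_dense => //; move: a01; rewrite in_itv.
Qed.
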